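(* Let $X$ be a proper geodesic $\delta$-hyperbolic metric space, let $b \in \hat{\mathcal{B}}(X)$ with basepoint $\omega \in X \cup \partial X$, and suppose that $X$ is $K$-roughly starlike from $\omega$. Let $\varepsilon > 0$ be such that $\rho_{\varepsilon}(x) = e^{-\varepsilon b(x)}$ is a GH-density for $X$ with constant $M$. Let $\mu$ be a Borel regular measure on $X$ that is doubling on balls of radius at most $R_{0}$ with constant $C_\mu$, and let $\beta>0$. Suppose that there is a constant $C_{0} \geq 1$ such that for any $\xi \in \partial X_{\varepsilon}$, $r > 0$, and $z \in X$, whenever $B_{\varepsilon}(z,\kappa_{1} r) \subset B_{\varepsilon}(\xi,r)$ and $d_{\varepsilon}(z) \geq 2\kappa_{1} r$ we have $$\mu_{\beta}(B_{\varepsilon}(\xi,r)) \leq C_{0}r^{\beta/\varepsilon}\mu(B_{X}(z,R_{0})).$$ Then $\mu_{\beta}$ is doubling on $\bar{X}_{\varepsilon}$ with doubling constant $C_{\mu_{\beta}}$ depending only on $\delta$, $K$, $\varepsilon$, $M$, $\beta$, $R_0$, $C_\mu$ and $C_{0}$.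
   Context: A geodesic in a metric space $(X,d)$ is an isometric map $\gamma : I \to X$ of an interval $I \subset \mathbb{R}$; $X$ is geodesic if any two points are joined by a geodesic, and proper if closed balls are compact. A geodesic metric space is $\delta$-hyperbolic ($\delta \ge 0$) if all geodesic triangles are $\delta$-thin: each point of each edge lies within distance $\delta$ of some point on another edge. The Gromov boundary $\partial X$ is the set of geodesic rays $\gamma:[0,\infty)\to X$ modulo the equivalence of being at bounded distance; the class of $\gamma$ is its endpoint. For a geodesic ray $\gamma$, $b_{\gamma}(x) = \lim_{t\to\infty} (d(\gamma(t),x)-t)$. $\mathcal{B}(X) = \{b_{\gamma}+s : \gamma \text{ a geodesic ray in } X,\ s\in\mathbb{R}\}$; the basepoint of $b_\gamma+s$ is the endpoint $\omega\in\partial X$ of $\gamma$. For $z \in X$, $b_{z}(x) = d(x,z)$, and $\mathcal{D}(X) = \{b_{z}+s: z\in X, s\in\mathbb{R}\}$; the basepoint of $b_z+s$ is $z$. $\hat{\mathcal{B}}(X) = \mathcal{D}(X)\cup\mathcal{B}(X)$. $X$ is $K$-roughly starlike ($K\ge 0$) from $z\in X$ if for each $x \in X$ there is a geodesic ray $\gamma:[0,\infty)\to X$ with $\gamma(0)=z$ and $\mathrm{dist}(x,\gamma)\le K$. $X$ is $K$-roughly starlike from $\omega\in\partial X$ if for each $x\in X$ there is a geodesic line $\gamma:\mathbb{R}\to X$ such that the ray $t\mapsto\gamma(-t)$, $t \ge 0$, belongs to the class $\omega$ and $\mathrm{dist}(x,\gamma)\le K$. For the fixed $b$ and $\varepsilon$,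 $\ell_{\varepsilon}(\gamma)=\int_\gamma\rho_{\varepsilon}\,ds$ for a curve $\gamma$, and $X_{\varepsilon}$ is the set $X$ with the metric $d_{\varepsilon}(x,y)=\inf\ell_{\varepsilon}(\gamma)$, the infimum over all curves $\gamma$ joining $x$ to $y$. $\bar X_{\varepsilon}$ is its completion, $\partial X_{\varepsilon}=\bar X_{\varepsilon}\setminus X_{\varepsilon}$, and $d_\varepsilon(x)=\mathrm{dist}(x,\partial X_\varepsilon)$ for $x\in X_\varepsilon$. $B_\varepsilon(x,r)$ is the open ball in $\bar X_\varepsilon$ for $d_\varepsilon$; $B_X(x,r)$ is the open ball in $(X,d)$. $\rho_{\varepsilon}$ is a GH-density with constant $M\ge1$ if for all $x,y\in X$ and each geodesic $\gamma$ of $(X,d)$ joining $x$ to $y$, $\ell_{\varepsilon}(\gamma)\le M\, d_{\varepsilon}(x,y)$. A Borel measure $\mu$ is doubling with constant $C_\mu\geq 1$ if $\mu(B(x,2r))\le C_\mu\,\mu(B(x,r))$ for all points $x$ and all $r>0$ (open balls); it is doubling on balls of radius at most $R_0$ if this holds for all $x$ and $0<r\le R_0$. For $\beta>0$, $\mu_{\beta}$ is defined by $d\mu_{\beta}(x)=e^{-\beta b(x)}d\mu(x)$ on $X$, extended to $\bar X_{\varepsilon}$ by $\mu_{\beta}(\partial X_{\varepsilon})=0$. $\kappa_1=\kappa_0/10$, where $\kappa_0=\kappa_0(\delta,K,\varepsilon,M)>0$ is a fixed constant, depending only on $\delta,K,\varepsilon,M$, such that for every $x\in\bar X_\varepsilon$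 and every $0<r\le2\,\mathrm{diam}\,X_\varepsilon$ there is a ball $B_\varepsilon(z,\kappa_0r)\subset B_\varepsilon(x,r)$ with $d_\varepsilon(z)\ge2\kappa_0r$ (such a constant exists). *)

(* Defs.v *)
From HB Require Import structures.
From mathcomp Require Import all_boot all_order all_algebra.
From mathcomp Require Import all_classical all_reals all_analysis.

Set Implicit Arguments.
Unset Strict Implicit.
Unset Printing Implicit Defensive.

Import Order.TTheory GRing.Theory Num.Theory.
Import numFieldNormedType.Exports.
Local Open Scope classical_set_scope.
Local Open Scope ring_scope.

Section GeodesicSpaces.
Context {R : realType} {X : metricType R}.
Implicit Types (x y z : X) (g : R -> X) (A E : set X) (K delta : R).

(* The value is +oo when A is empty. *)
Definition dist_set x A : \bar R := ereal_inf [set (mdist x a)%:E | a in A].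

(* Maps defined on an interval I are encoded as total maps R -> X of which only
   the values on I matter. *)
Definition geodesic_on (I : set R) g :=
  forall s t, I s -> I t -> mdist (g s) (g t) = `|s - t|.

Definition geodesic_joining (a c : R) g x y :=
  [/\ a <= c, geodesic_on `[a, c] g, g a = x & g c = y].

Definition geodesic_ray g := geodesic_on `[0, +oo[ g.

Definition ray_image g : set X := g @` `[0, +oo[.

Definition geodesic_line g := geodesic_on setT g.

Definition geodesic_space := forall x y, exists a c g, geodesic_joining a c g x y.

Definition proper_space := forall x (r : R), compact [set y | mdist x y <= r].

Definition geodesic_edge x y E :=
  exists a c g, geodesic_joining a c g x y /\ E = g @` `[a, c].

Definition within_dist delta E A :=
  forall p, E p -> exists2 q, A q & mdist p q <= delta.

Definition gromov_hyperbolic delta :=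
  forall x y z E1 E2 E3,
    geodesic_edge x y E1 -> geodesic_edge y z E2 -> geodesic_edge z x E3 ->
  [/\ within_dist delta E1 (E2 `|` E3),
      within_dist delta E2 (E3 `|` E1) &
      within_dist delta E3 (E1 `|` E2)].

Definition ray_equiv g g' :=
  exists c : R, forall t, 0 <= t -> mdist (g t) (g' t) <= c.

(* Points of the Gromov boundary are the equivalence classes of rays themselves,
   as sets of rays. *)
Definition endpoint g : set (R -> X) :=
  [set g' | geodesic_ray g' /\ ray_equiv g g'].

Definition gromov_boundary : set (set (R -> X)) :=
  [set endpoint g | g in [set g | geodesic_ray g]].

Definition busemann g x : R := lim ((mdist (g t) x - t) @[t --> +oo%R]).

(* b belongs to the class of distance-like and Busemann functions, and its
   basepoint, in X (inl) or in the Gromov boundary (inr), is w. *)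
Definition has_basepoint (b : X -> R) (w : X + set (R -> X)) :=
  match w with
  | inl z => exists s : R, forall x, b x = mdist x z + s
  | inr c => exists g (s : R),
      [/\ geodesic_ray g, c = endpoint g & forall x, b x = busemann g x + s]
  end.

Definition roughly_starlike K (w : X + set (R -> X)) :=
  match w with
  | inl z => forall x, exists g,
      [/\ geodesic_ray g, g 0 = z & (dist_set x (ray_image g) <= K%:E)%E]
  | inr c => forall x, exists g,
      [/\ geodesic_line g, c (fun t => g (- t))
        & (dist_set x (range g) <= K%:E)%E]
  end.

End GeodesicSpaces.

Arguments geodesic_space {R} X.
Arguments proper_space {R} X.
Arguments gromov_hyperbolic {R} X delta.
Arguments gromov_boundary {R} X.

Section Uniformization.
Context {R : realType} {X : metricType R}.
Implicit Types (x y : X) (g : R -> X) (a c : R) (rho : X -> R).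

Definition curve_joining a c g x y :=
  [/\ a <= c, {within `[a, c], continuous g}, g a = x & g c = y].

Definition polygonal_length a c g (s : seq R) : R :=
  let F := g \o nth c (a :: s) in
  \sum_(0 <= n < size s) mdist (F n) (F n.+1).

Definition curve_length a c g : \bar R :=
  ereal_sup [set (polygonal_length a c g s)%:E | s in itv_partition a c].

(* The arc-length parametrization of g on [0, curve_length a c g]; the chosen u
   is irrelevant, since g is constant where the arc length is. *)
Definition arc_length_param a c g (t : R) : X :=
  g (xget a [set u | u \in `[a, c] /\ curve_length a u g = t%:E]).

(* The integral of rho > 0 along g with respect to arc length, equal to +oo on
   nonrectifiable curves. *)
Definition weighted_length rho a c g : \bar R :=
  if curve_length a c g is L%:E then
    (\int[lebesgue_measure]_(t in `[0%R, L]) (rho (arc_length_param a c g t))%:E)%E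
  else +oo%E.

Definition weighted_dist rho x y : \bar R :=
  ereal_inf [set l | exists a c g,
    curve_joining a c g x y /\ l = weighted_length rho a c g].

Definition weighted_diam rho : \bar R :=
  ereal_sup [set l | exists x y, l = weighted_dist rho x y].

Definition GH_density rho (M : R) :=
  forall x y a c g, geodesic_joining a c g x y ->
    (weighted_length rho a c g <= M%:E * weighted_dist rho x y)%E.

Definition rho_eps (eps : R) (b : X -> R) x : R := expR (- (eps * b x)).

(* i : X -> Y exhibits the metric space Y as a completion of X endowed with the
   metric weighted_dist rho; this determines Y up to a unique isometry. *)
Definition is_completion rho (Y : metricType R) (i : X -> Y) :=
  [/\ forall x y, (mdist (i x) (i y))%:E = weighted_dist rho x y,
      dense (range i) &
      forall F : set_system Y, ProperFilter F -> cauchy F -> exists p : Y, F --> p].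

Definition metric_boundary (Y : metricType R) (i : X -> Y) : set Y :=
  ~` range i.

Definition dist_boundary (Y : metricType R) (i : X -> Y) x : \bar R :=
  dist_set (i x) (metric_boundary i).

Definition uniformization (delta K eps M : R) (b : X -> R)
    (w : X + set (R -> X)) (Y : metricType R) (i : X -> Y) :=
  [/\ [/\ proper_space X, geodesic_space X & gromov_hyperbolic X delta],
      has_basepoint b w,
      roughly_starlike K w,
      GH_density (rho_eps eps b) M &
      is_completion (rho_eps eps b) i].

Definition corkscrew (kappa eps : R) (b : X -> R) (Y : metricType R)
    (i : X -> Y) :=
  forall (y : Y) (r : R), 0 < r ->
    (r%:E <= 2%:E * weighted_diam (rho_eps eps b))%E ->
  exists z : X, ball (i z) (kappa * r) `<=` ball y r /\
    ((2 * kappa * r)%:E <= dist_boundary i z)%E.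

End Uniformization.

Definition admissible (R : realType) (delta K eps M : R) :=
  [/\ 0 <= delta, 0 <= K, 0 < eps & 1 <= M].

(* kappa0 chooses, from delta, K, eps and M only, a constant that works for all
   spaces with these parameters. *)
Definition corkscrew_constant (R : realType) (kappa0 : R -> R -> R -> R -> R) :=
  forall delta K eps M : R, admissible delta K eps M ->
    0 < kappa0 delta K eps M /\
    forall (X : metricType R) (b : X -> R) (w : X + set (R -> X))
      (Y : metricType R) (i : X -> Y),
    uniformization delta K eps M b w i ->
    corkscrew (kappa0 delta K eps M) eps b i.

#[short(type="metricMeasurableType")]
HB.structure Definition MetricMeasurable (d : measure_display) (R : realType) :=
  { T of Metric R T & Measurable d T }.

Section Measures.
Context {R : realType}.

Definition doubling_upto (T : metricType R) (m : set T -> \bar R) (C R0 : R) :=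
  forall (x : T) (r : R), 0 < r -> r <= R0 ->
    (m (ball x (2 * r)) <= C%:E * m (ball x r))%E.

Definition doubling (T : metricType R) (m : set T -> \bar R) (C : R) :=
  forall (x : T) (r : R), 0 < r ->
    (m (ball x (2 * r)) <= C%:E * m (ball x r))%E.

Context {d : measure_display} {X : metricMeasurableType d R}.

(* The domain of mu may be any sigma-algebra containing the Borel sets: the
   Borel sets themselves, for which the second clause is automatic, or the
   Caratheodory measurable sets of a Borel regular outer measure. *)
Definition borel_regular (mu : {measure set X -> \bar R}) :=
  @open X `<=` measurable /\
  forall A : set X, measurable A ->
    exists B : set X, [/\ <<s @open X >> B, A `<=` B & mu B = mu A].

(* The extension to the completion i : X -> Y; the boundary ~` range i has
   measure 0 because its preimage is empty. *)
Definition mu_beta (mu : {measure set X -> \bar R}) (beta : R) (b : X -> R)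
    (Y : metricType R) (i : X -> Y) (A : set Y) : \bar R :=
  (\int[mu]_(x in i @^-1` A) (expR (- (beta * b x)))%:E)%E.

End Measures.

(* Main.v *)
Require Import Defs.
From HB Require Import structures.
From mathcomp Require Import all_boot all_order all_algebra.
From mathcomp Require Import all_classical all_reals all_analysis.
From mathcomp Require Import ring lra.

Set Implicit Arguments.
Unset Strict Implicit.
Unset Printing Implicit Defensive.

Import Order.TTheory GRing.Theory Num.Theory.
Import numFieldNormedType.Exports.
Local Open Scope classical_set_scope.
Local Open Scope ring_scope.

(** Write [rho = exp (- eps * b)], [d] for the metric of [X] and [d_eps] for the
    metric of the completion [Y], with boundary the complement of [X].

    The function [b] is a pointwise limit of functions [d (p_t, .) - s_t]
    ([basepoint_distance_limit]); hence it is 1-Lipschitz, and on a geodesic it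
    exceeds the maximum of its values at the ends by at most [delta]
    ([distance_limit_quasiconvex]).  Four comparisons of metrics follow:
    - [d_eps x y <= d x y * exp (eps * d x y) * rho x], integrating along a
      geodesic ([weighted_dist_le_mdist]);
    - [d_eps x y >= exp (- eps) * rho x * min 1 (d x y)], as a curve spends a
      unit of length in the unit ball before leaving it
      ([weighted_dist_ge_mdist]);
    - [d x y * min (rho x) (rho y)] is at most a constant times [d_eps x y], by
      the Gehring-Hayman inequality and quasiconvexity ([GH_density_mdist_le]);
    - the distance of [x] to the boundary is comparable to [rho x].  The lower
      bound comes from compactness of the balls of [X] ([boundary_mdist_ge]), the
      upper bound from rough starlikeness: near [x] starts a ray along which [b]
      grows at unit rate up to an additive constant, so that the ray has finite
      [eps]-length and ends on the boundary ([boundary_mdist_le]).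

    The local doubling property of [mu] passes to all bounded radii because [X]
    is geodesic ([doubling_upto_extend]).

    Now let [B] be the ball of [Y] with center [y] and radius [r].  If the
    boundary is at distance at least [4 r] from [y], then [y] is a point of [X],
    both [B] and its double are comparable with balls of [X] whose radii are
    bounded and have a bounded ratio, and [exp (- beta * b)] is nearly constant
    there ([doubling_far_ball]).  Otherwise the double of [B] lies in the ball of
    radius [10 r] around a boundary point [xi].  The corkscrew condition gives
    [z] with the ball of radius [kappa0 r = kappa1 (10 r)] around [z] inside [B]
    and far from the boundary; the assumed bound at [xi] controls the double of
    [B] by [r `^ (beta / eps) * mu (ball z R0)], while [rho z] is comparable to
    [r], so that [B] contains a ball of [X] around [z] whose weighted measure is
    at least a multiple of this quantity ([doubling_near_ball]). *)

(** * Integrals, arc length and weighted length *)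

Section Integral.
Context d (T : measurableType d) (R : realType) (mu : {measure set T -> \bar R}).
Local Open Scope ereal_scope.

(** The integral of a nonnegative function is a supremum over the simple
    functions below it, so it is monotone for arbitrary functions, such as the
    density along a curve. *)
Lemma ge0_integral_mono (A B : set T) (f g : T -> \bar R) :
  A `<=` B -> (forall x, A x -> 0 <= f x <= g x) -> (forall x, B x -> 0 <= g x) ->
  \int[mu]_(x in A) f x <= \int[mu]_(x in B) g x.
Proof.
move=> AB fg g0; rewrite !ge0_integralE//; last by move=> x /fg /andP[].
apply: le_ereal_sup => _ [h /= hf <-]; exists h => // x.
apply: (le_trans (hf x)); rewrite /patch; case: ifPn => [/set_mem Ax|_].
  by rewrite (mem_set (AB _ Ax)); case/andP: (fg _ Ax).
by case: ifPn => // /set_mem /g0.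
Qed.

Lemma integral_le_cst (A : set T) (f : T -> R) (c : R) : measurable A ->
  (forall x, A x -> 0 <= f x <= c)%R ->
  \int[mu]_(x in A) (f x)%:E <= c%:E * mu A.
Proof.
move=> mA fc; rewrite -integral_cst//; apply: ge0_integral_mono => // x Ax.
by rewrite lee_fin/=; case/andP: (fc x Ax); exact: le_trans.
Qed.

Lemma integral_ge_cst (A B : set T) (f : T -> R) (c : R) : measurable A ->
  A `<=` B -> (0 <= c)%R -> (forall x, B x -> 0 <= f x)%R ->
  (forall x, A x -> c <= f x)%R ->
  c%:E * mu A <= \int[mu]_(x in B) (f x)%:E.
Proof.
move=> mA AB c0 f0 cf; rewrite -integral_cst//; apply: ge0_integral_mono => // x Ax.
by rewrite !lee_fin/= c0 cf.
Qed.

End Integral.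

Section CurveLength.
Context {R : realType} {X : metricType R}.
Implicit Types (x y z : X) (g : R -> X) (a c u t L : R) (rho : X -> R).

Lemma polygonal_length_cons a c g t s :
  polygonal_length a c g (t :: s) = mdist (g a) (g t) + polygonal_length t c g s.
Proof. by rewrite /polygonal_length /= big_nat_recl. Qed.

Lemma curve_length_ge_mdist a c g : a <= c ->
  ((mdist (g a) (g c))%:E <= curve_length a c g)%E.
Proof.
rewrite le_eqVlt => /predU1P[<-|ac]; apply: ereal_sup_ubound.
  exists [::]; first by split => //=.
  by rewrite mdistxx /polygonal_length big_nil.
exists [:: c]; first exact: itv_partition1.
by rewrite polygonal_length_cons /polygonal_length big_nil addr0.
Qed.

Lemma geodesic_polygonal_length a c g s : geodesic_on `[a, c] g ->
  itv_partition a c s -> polygonal_length a c g s = c - a.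
Proof.
elim: s a => [|t s IH] a gg acs.
  by rewrite (itv_partition_nil acs) /polygonal_length big_nil subrr.
have [at_ tcs] : a < t /\ itv_partition t c s.
  by case: acs => /= /andP[at_ ts] tc; split.
have tc := itv_partition_le tcs.
rewrite polygonal_length_cons IH//; last first.
  move=> u v; rewrite /= !in_itv/= => /andP[tu uc] /andP[tv vc].
  by apply: gg; rewrite /= in_itv/= ?uc ?vc ?(le_trans (ltW at_)).
rewrite gg; last 2 first.
- by rewrite /= in_itv/= lexx (le_trans (ltW at_)).
- by rewrite /= in_itv/= tc (ltW at_).
by rewrite ltr0_norm ?subr_lt0//; lra.
Qed.

Lemma geodesic_curve_length a c g : a <= c -> geodesic_on `[a, c] g ->
  curve_length a c g = (c - a)%:E.
Proof.
move=> ac gg; apply/eqP; rewrite eq_le; apply/andP; split.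
  apply: ge_ereal_sup => _ [s acs <-].
  by rewrite (geodesic_polygonal_length gg acs).
apply: le_trans (curve_length_ge_mdist g ac).
rewrite gg /= ?in_itv/= ?lexx ?ac// lee_fin distrC ger0_norm ?subr_ge0//.
Qed.

(** On a geodesic the arc length from [a] to [u] is [u - a], so the parameter of
    arc length [t] is unique. *)
Lemma geodesic_arc_length_param a c g t : geodesic_on `[a, c] g ->
  0 <= t <= c - a -> arc_length_param a c g t = g (a + t).
Proof.
move=> gg /andP[t0 tc]; rewrite /arc_length_param; congr g.
apply: xget_unique => /=.
  rewrite in_itv/= lerDl t0 -lerBrDl tc; split => //.
  rewrite geodesic_curve_length ?lerDl// ?(addrC a) ?addrK//.
  move=> u v; rewrite /= !in_itv/= => /andP[au uc] /andP[av vc].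
  by apply: gg; rewrite /= in_itv/= ?au ?av/=; lra.
move=> u [/=]; rewrite in_itv/= => /andP[au uc].
rewrite geodesic_curve_length// => [[<-]|]; first by lra.
move=> v w; rewrite /= !in_itv/= => /andP[av vu] /andP[aw wu].
by apply: gg; rewrite /= in_itv/= ?av ?aw/=; lra.
Qed.

(** Where the arc length [t] is not attained, the default value of the
    parametrization is the origin of the curve, so this holds for all [t >= 0]. *)
Lemma mdist_arc_length_param a c g t : 0 <= t ->
  mdist (g a) (arc_length_param a c g t) <= t.
Proof.
move=> t0; rewrite /arc_length_param; case: xgetP => [u _ [/=]|_].
  rewrite in_itv/= => /andP[au _] ut.
  by rewrite -lee_fin -ut curve_length_ge_mdist.
by rewrite mdistxx.
Qed.

Lemma geodesic_within_continuous a c g : geodesic_on `[a, c] g ->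
  {within `[a, c], continuous g}.
Proof.
move=> gg; apply/subspace_continuousP => t tac.
apply/metricType_numDomainType.cvgrPdist_lt => e e0.
rewrite near_withinE; apply: (filterS _ (nbhsx_ballx t _ e0)) => u tu uac.
by rewrite gg.
Qed.

Lemma geodesic_weighted_lengthE rho a c g : a <= c -> geodesic_on `[a, c] g ->
  weighted_length rho a c g =
  (\int[lebesgue_measure]_(t in `[0%R, (c - a)%R])
     (rho (arc_length_param a c g t))%:E)%E.
Proof. by move=> ac gg; rewrite /weighted_length geodesic_curve_length. Qed.

Lemma lebesgue_measure_segment L : 0 <= L ->
  lebesgue_measure (`[0, L]%classic : set R) = L%:E.
Proof.
rewrite le_eqVlt => /predU1P[<-|L0]; first by rewrite lebesgue_measure_itv/= ltxx.
by rewrite lebesgue_measure_itv/= lte_fin L0 oppr0 adde0.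
Qed.

Lemma geodesic_weighted_length_le rho a c g m : a <= c ->
  geodesic_on `[a, c] g -> (forall t, a <= t <= c -> 0 <= rho (g t) <= m) ->
  (weighted_length rho a c g <= (m * (c - a))%:E)%E.
Proof.
move=> ac gg rm; rewrite geodesic_weighted_lengthE// EFinM.
rewrite -[X in (_ * X)%E]lebesgue_measure_segment ?subr_ge0//.
apply: integral_le_cst => // t; rewrite /= in_itv/= => /andP[t0 tc].
by rewrite (geodesic_arc_length_param gg) ?t0//; apply: rm; lra.
Qed.

Lemma geodesic_weighted_length_ge rho a c g m : a <= c -> 0 <= m ->
  geodesic_on `[a, c] g -> (forall t, a <= t <= c -> m <= rho (g t)) ->
  ((m * (c - a))%:E <= weighted_length rho a c g)%E.
Proof.
move=> ac m0 gg rm; rewrite geodesic_weighted_lengthE// EFinM.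
rewrite -[X in (_ * X)%E]lebesgue_measure_segment ?subr_ge0//.
have rmt t : `[0, c - a]%classic t -> m <= rho (arc_length_param a c g t).
  rewrite /= in_itv/= => /andP[t0 tc].
  by rewrite (geodesic_arc_length_param gg) ?t0//; apply: rm; lra.
by apply: integral_ge_cst => // t /rmt; exact: le_trans.
Qed.

Lemma weighted_dist_le_geodesic rho a c g x y : geodesic_joining a c g x y ->
  (weighted_dist rho x y <= weighted_length rho a c g)%E.
Proof.
move=> [ac gg ga gc]; apply: ereal_inf_lbound; exists a, c, g; split => //.
by split => //; exact: geodesic_within_continuous.
Qed.

(** A curve cannot leave the unit ball around its origin without first running
    through a unit of arc length inside it. *)
Lemma weighted_dist_ge rho x y m : (forall z, 0 <= rho z) -> 0 <= m ->
  (forall z, mdist x z <= 1 -> m <= rho z) ->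
  ((m * Num.min 1 (mdist x y))%:E <= weighted_dist rho x y)%E.
Proof.
move=> rho0 m0 mr; apply: le_ereal_inf_tmp => _ [a [c [g [[ac _ ga gc] ->]]]].
subst x y.
rewrite /weighted_length.
have := curve_length_ge_mdist g ac.
case: (curve_length a c g) => [L|_|]; [|by rewrite leey|by rewrite leeNy_eq].
rewrite lee_fin => dL.
set q := Num.min _ _; have q0 : 0 <= q by rewrite le_min ler01 mdist_ge0.
have qL : q <= L by rewrite ge_min dL orbT.
rewrite EFinM -[X in (_ * X)%E]lebesgue_measure_segment//.
apply: integral_ge_cst => // t; rewrite /= !in_itv/= => /andP[t0 tq].
  by rewrite t0 (le_trans tq).
apply: mr; apply: (le_trans (mdist_arc_length_param a c g t0)).
by rewrite (le_trans tq)// ge_min lexx.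
Qed.

End CurveLength.

(** * Busemann functions in hyperbolic spaces *)

Section Hyperbolic.
Context {R : realType} {X : metricType R}.
Implicit Types (x y z p q : X) (g : R -> X) (a c t u K delta : R) (b : X -> R).

Lemma mdist_triangleC p x y : mdist p x - mdist p y <= mdist x y.
Proof. by rewrite lerBlDl (metric_sym x y); exact: metric_triangle. Qed.

Lemma geodesic_betweenness a c g x y t : geodesic_joining a c g x y ->
  a <= t <= c -> mdist x (g t) + mdist (g t) y = mdist x y.
Proof.
move=> [ac gg <- <-] /andP[at_ tc].
rewrite !gg /= ?in_itv/= ?lexx ?ac ?at_ ?tc//.
by rewrite !ler0_norm ?subr_le0//; lra.
Qed.

Lemma geodesic_edge_betweenness x y E q : geodesic_edge x y E -> E q ->
  mdist x q + mdist q y = mdist x y.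
Proof.
move=> [a [c [g [gxy ->]]]] [t /=]; rewrite in_itv/= => act <-.
exact: geodesic_betweenness gxy act.
Qed.

(** Thinness of triangles, with membership of [q] in a side recorded as equality
    in the triangle inequality, which is all that distance estimates consume. *)
Lemma thin_triangle delta a c g x y p t :
  geodesic_space X -> gromov_hyperbolic X delta -> geodesic_joining a c g x y ->
  a <= t <= c ->
  exists2 q, mdist (g t) q <= delta &
    mdist y q + mdist q p = mdist y p \/ mdist p q + mdist q x = mdist p x.
Proof.
move=> geoX hypX gxy act.
have [a2 [c2 [g2 h2]]] := geoX y p; have [a3 [c3 [g3 h3]]] := geoX p x.
have e1 : geodesic_edge x y (g @` `[a, c]) by exists a, c, g.
have e2 : geodesic_edge y p (g2 @` `[a2, c2]) by exists a2, c2, g2.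
have e3 : geodesic_edge p x (g3 @` `[a3, c3]) by exists a3, c3, g3.
have [thin _ _] := hypX _ _ _ _ _ _ e1 e2 e3.
have [|q qE gq] := thin (g t); first by exists t => //=; rewrite in_itv.
exists q => //; case: qE => [q2|q3]; [left|right].
  exact: geodesic_edge_betweenness e2 q2.
exact: geodesic_edge_betweenness e3 q3.
Qed.

(** Distance functions and Busemann functions are both of this form, and their
    common properties pass to the limit from distance functions. *)
Definition distance_limit b := exists (p : R -> X) (s : R -> R),
  forall x, (mdist (p t) x - s t) @[t --> +oo] --> b x.

Lemma busemann_cvg g x : geodesic_ray g ->
  (mdist (g t) x - t) @[t --> +oo] --> busemann g x.
Proof.
move=> gg.
(* truncation of the parameter at 0 makes the function monotone on all of R *)
pose f t := Num.max t 0 - mdist (g (Num.max t 0)) x.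
have g0 t : 0 <= t -> `[0, +oo[%classic t by move=> t0; rewrite /= in_itv/= t0.
have ndf : nondecreasing_fun f.
  move=> s t st; rewrite /f.
  have st' : Num.max s 0 <= Num.max t 0 by rewrite ge_max !le_max st lexx !orbT.
  have := mdist_triangleC x (g (Num.max t 0)) (g (Num.max s 0)).
  rewrite gg; [|by apply: g0; rewrite le_max lexx orbT..].
  rewrite ger0_norm ?subr_ge0// => h.
  by rewrite (metric_sym _ x) (metric_sym (g (Num.max t 0)) x); lra.
have ubf : has_ubound (range f).
  exists (mdist (g 0) x) => _ [t _ <-]; rewrite /f.
  have m0 : 0 <= Num.max t 0 by rewrite le_max lexx orbT.
  have := metric_triangle (g (Num.max t 0)) x (g 0).
  rewrite gg ?subr0; [|exact: g0..].
  by rewrite ger0_norm// (metric_sym x); lra.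
have /cvgN fcv := nondecreasing_cvgr ndf ubf.
apply: cvgP (- sup (range f)) _; apply: cvg_trans fcv; apply: near_eq_cvg.
near=> t; rewrite /= fctE /f max_l ?opprB//; near: t; exact: nbhs_pinfty_ge.
Unshelve. all: by end_near. Qed.

Lemma basepoint_distance_limit b w : has_basepoint b w -> distance_limit b.
Proof.
case: w => [z [s bE]|c [g [s [gg _ bE]]]].
  exists (fun=> z), (fun=> - s) => x; rewrite bE.
  rewrite [X in X @ _](_ : _ = fun=> mdist x z + s); first exact: cvg_cst.
  by apply/funext => t; rewrite opprK metric_sym.
exists g, (fun t => t - s) => x; rewrite bE.
rewrite [X in X @ _](_ : _ = (fun t => mdist (g t) x - t) + cst s).
  exact: cvgD (busemann_cvg gg) (cvg_cst s).
by apply/funext => t; rewrite fctE opprB addrA addrAC.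
Qed.

Lemma distance_limit_lipschitz b x y : distance_limit b ->
  b x - b y <= mdist x y.
Proof.
move=> [p [s bl]]; apply: (cvgr_to_le (cvgB (bl x) (bl y))).
by apply: nearW => t; have := mdist_triangleC (p t) x y; rewrite !fctE; lra.
Qed.

(** Seen from [p], a point of the side [x y] of a thin triangle is within [delta]
    of one of the two sides at [p], so it is not farther than [x] or [y] by more
    than [delta]. *)
Lemma distance_limit_quasiconvex delta b a c g x y t :
  geodesic_space X -> gromov_hyperbolic X delta -> distance_limit b ->
  geodesic_joining a c g x y -> a <= t <= c ->
  b (g t) <= Num.max (b x) (b y) + delta.
Proof.
move=> geoX hypX [p [s bl]] gxy act.
rewrite -lerBlDr leNgt; apply/negP; rewrite gt_max => /andP[bx by_].
(* far out along [p], the point [g t] is more than delta farther than both ends *)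
have far z : b z < b (g t) - delta ->
    pinfty_nbhs R (fun u => mdist (p u) z + delta < mdist (p u) (g t)).
  move=> bz; have dz : delta < b (g t) - b z by lra.
  have h := cvgr_gt _ (cvgB (bl (g t)) (bl z)) _ dz.
  by near=> u; have : delta < mdist (p u) (g t) - s u - (mdist (p u) z - s u);
    [near: u; exact: h|lra].
have [u [ux uy]] := filter_ex (filterI (far _ bx) (far _ by_)).
have [q gq e] := thin_triangle (p u) geoX hypX gxy act.
have := metric_triangle (p u) q (g t); rewrite (metric_sym q (g t)).
case: e; rewrite ?(metric_sym q) ?(metric_sym y).
  by have := mdist_ge0 y q; rewrite (metric_sym y q); lra.
by have := mdist_ge0 x q; rewrite (metric_sym x q); lra.
Unshelve. all: by end_near. Qed.

(** In the triangle with vertices [g (- u)], [g t] and [g0 u], for large [u], the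
    point [g t0] is too far from the short side between the line and the ray;
    so it is close to the side from [g t] to [g0 u], which must then be longer
    than the distance from [g t0] to [g0 u] by almost [t - t0]. *)
Lemma busemann_line_growth delta g0 g c t0 t :
  geodesic_space X -> gromov_hyperbolic X delta ->
  geodesic_ray g0 -> geodesic_line g ->
  (forall u, 0 <= u -> mdist (g0 u) (g (- u)) <= c) -> t0 <= t ->
  busemann g0 (g t0) + (t - t0) - 2 * delta <= busemann g0 (g t).
Proof.
move=> geoX hypX gg0 gg cP t0t.
suff : t - t0 - 2 * delta <= busemann g0 (g t) - busemann g0 (g t0) by lra.
apply: (cvgr_to_ge (cvgB (@busemann_cvg g0 _ gg0) (@busemann_cvg g0 _ gg0))).
near=> u; rewrite !fctE.
have u0 : 0 <= u by near: u; exact: nbhs_pinfty_ge.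
have ut0 : - t0 <= u by near: u; apply: nbhs_pinfty_ge; exact: num_real.
have ud : delta + c - t0 < u by near: u; apply: nbhs_pinfty_gt; exact: num_real.
have gut : geodesic_joining (- u) t g (g (- u)) (g t).
  by split => //; [lra|move=> r s _ _; exact: gg].
have act : - u <= t0 <= t by rewrite t0t andbT; lra.
have [q gq e] := thin_triangle (g0 u) geoX hypX gut act.
have gt0t : mdist (g t) (g t0) = t - t0 by rewrite gg// ger0_norm ?subr_ge0.
have gt0u : mdist (g t0) (g (- u)) = t0 + u.
  by rewrite gg// opprK ger0_norm//; lra.
case: e => e.
  have := metric_triangle (g0 u) q (g t0).
  have := metric_triangle (g t) q (g t0).
  rewrite (metric_sym q (g t0)) (metric_sym (g0 u) q) (metric_sym (g0 u) (g t)); lra.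
have := cP _ u0.
have := metric_triangle (g t0) q (g (- u)).
by have := mdist_ge0 (g0 u) q; lra.
Unshelve. all: by end_near. Qed.

Lemma dist_set_image_lt x g (I : set R) K : (dist_set x (g @` I) <= K%:E)%E ->
  exists2 t, I t & mdist x (g t) < K + 1.
Proof.
move=> dK.
have : (dist_set x (g @` I) < (K + 1)%:E)%E.
  by apply: le_lt_trans dK _; rewrite lte_fin ltrDl.
by move=> /ereal_inf_lt[_ [_ [t It <-] <-]]; rewrite lte_fin => tK; exists t.
Qed.

(** The ray is what remains of a starlikeness ray or line past its point near
    [x]; from here on the two kinds of basepoint need no distinction. *)
Lemma starlike_escape delta K b w x :
  geodesic_space X -> gromov_hyperbolic X delta -> 0 <= delta ->
  has_basepoint b w -> roughly_starlike K w ->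
  exists g, [/\ geodesic_ray g, mdist x (g 0) <= K + 1 &
    forall t, 0 <= t -> b (g 0) + t - 2 * delta <= b (g t)].
Proof.
move=> geoX hypX delta0; case: w => [z [s bE]|c [g0 [s [gg0 cE bE]]]] star.
  have [g [gg gz xg]] := star x.
  have [t0 /=] := dist_set_image_lt xg; rewrite in_itv/= andbT => t00 xt0.
  have gI t : 0 <= t -> `[0, +oo[%classic t by move=> ?; rewrite /= in_itv/= andbT.
  exists (fun t => g (t0 + t)); split.
  - move=> u v; rewrite /= !in_itv/= !andbT => u0 v0.
    by rewrite gg; [congr `|_|; ring|apply: gI; lra..].
  - by rewrite addr0 ltW.
  - move=> t t_ge0; rewrite !bE -gz.
    have gE r : 0 <= r -> mdist (g r) (g 0) = r.
      by move=> r0; rewrite gg ?subr0 ?ger0_norm//; apply: gI.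
    by rewrite addr0 !gE//; lra.
have [g [gg cg xg]] := star x.
have [t0 _ xt0] := dist_set_image_lt xg.
move: cg; rewrite cE => -[_ [C gC]].
exists (fun t => g (t0 + t)); split.
- by move=> u v _ _; rewrite gg//; congr `|_|; ring.
- by rewrite addr0 ltW.
- move=> t t_ge0; rewrite !bE addr0.
  have t0t : t0 <= t0 + t by rewrite lerDl.
  by have := busemann_line_growth geoX hypX gg0 gg gC t0t; lra.
Qed.

End Hyperbolic.

(** * The uniformized metric and the distance to its boundary *)

Section UniformizedMetric.
Context {R : realType} {X : metricType R}.
Implicit Types (x y z : X) (g : R -> X) (a c t u K delta eps M : R) (b : X -> R).

Lemma rho_eps_gt0 eps b x : 0 < rho_eps eps b x.
Proof. exact: expR_gt0. Qed.

Lemma rho_eps_ge0 eps b x : 0 <= rho_eps eps b x.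
Proof. exact: expR_ge0. Qed.

Lemma rho_eps_le eps b x y r : 0 < eps -> b x - b y <= r ->
  rho_eps eps b y <= expR (eps * r) * rho_eps eps b x.
Proof.
move=> eps0 bxy; rewrite /rho_eps -expRD ler_expR.
have := ler_wpM2l (ltW eps0) bxy; lra.
Qed.

Lemma weighted_dist_le_mdist eps b x y : 0 < eps -> geodesic_space X ->
  distance_limit b ->
  (weighted_dist (rho_eps eps b) x y <=
     (mdist x y * expR (eps * mdist x y) * rho_eps eps b x)%:E)%E.
Proof.
move=> eps0 geoX bl; have [a [c [g gxy]]] := geoX x y.
apply: le_trans (weighted_dist_le_geodesic _ gxy) _.
have [ac gg ga gc] := gxy.
have xyE : mdist x y = c - a.
  rewrite -ga -gc gg /= ?in_itv/= ?lexx ?ac// distrC ger0_norm ?subr_ge0//.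
rewrite -mulrA mulrC {2}xyE.
apply: geodesic_weighted_length_le => // t act.
rewrite rho_eps_ge0 /=; apply: rho_eps_le => //.
apply: le_trans (distance_limit_lipschitz x (g t) bl) _.
by rewrite -(geodesic_betweenness gxy act) lerDl mdist_ge0.
Qed.

Lemma weighted_dist_ge_mdist eps b x y : 0 < eps -> distance_limit b ->
  ((expR (- eps) * rho_eps eps b x * Num.min 1 (mdist x y))%:E <=
     weighted_dist (rho_eps eps b) x y)%E.
Proof.
move=> eps0 bl; apply: weighted_dist_ge => [z||z xz].
- exact: rho_eps_ge0.
- by rewrite mulr_ge0 ?expR_ge0.
rewrite -ler_pdivlMl ?expR_gt0// -expRN opprK -{2}[eps]mulr1.
apply: rho_eps_le => //; apply: le_trans (distance_limit_lipschitz z x bl) _.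
by rewrite metric_sym.
Qed.

(** Quasiconvexity of [b] keeps the density bounded below along a geodesic, so
    the Gehring-Hayman inequality turns into a bound on the hyperbolic distance
    of two points with comparable densities. *)
Lemma GH_density_mdist_le eps b delta M x y : 0 < eps ->
  geodesic_space X -> gromov_hyperbolic X delta -> distance_limit b ->
  GH_density (rho_eps eps b) M ->
  ((mdist x y * expR (- (eps * delta))
      * Num.min (rho_eps eps b x) (rho_eps eps b y))%:E
    <= M%:E * weighted_dist (rho_eps eps b) x y)%E.
Proof.
move=> eps0 geoX hypX bl GH; have [a [c [g gxy]]] := geoX x y.
apply: le_trans (GH _ _ _ _ _ gxy).
have [ac gg ga gc] := gxy.
have xyE : mdist x y = c - a.
  rewrite -ga -gc gg /= ?in_itv/= ?lexx ?ac// distrC ger0_norm ?subr_ge0//.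
rewrite -mulrA mulrC xyE.
apply: geodesic_weighted_length_ge => // [|t act].
  by rewrite mulr_ge0 ?expR_ge0// le_min !rho_eps_ge0.
have qc := distance_limit_quasiconvex geoX hypX bl gxy act.
have [bxy|/ltW bxy] := leP (b x) (b y); rewrite ?(max_r bxy) ?(max_l bxy) in qc.
  apply: (@le_trans _ _ (expR (- (eps * delta)) * rho_eps eps b y)).
    by rewrite ler_wpM2l ?expR_ge0// ge_min lexx orbT.
  rewrite -ler_pdivlMl ?expR_gt0// -expRN opprK; apply: rho_eps_le => //; lra.
apply: (@le_trans _ _ (expR (- (eps * delta)) * rho_eps eps b x)).
  by rewrite ler_wpM2l ?expR_ge0// ge_min lexx.
rewrite -ler_pdivlMl ?expR_gt0// -expRN opprK; apply: rho_eps_le => //; lra.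
Qed.

End UniformizedMetric.

Section GeometricCauchy.
Context {R : realType} {Y : metricType R}.
Implicit Types (u : nat -> Y) (A q : R).

Lemma geometric_mdist_le u A q : 0 <= A -> 0 <= q < 1 ->
  (forall n, mdist (u n) (u n.+1) <= A * q ^+ n) ->
  forall m k, mdist (u m) (u (m + k)%N) <= A / (1 - q) * q ^+ m.
Proof.
move=> A0 /andP[q0 q1] uq m k.
have q10 : 0 < 1 - q by rewrite subr_gt0.
suff h : mdist (u m) (u (m + k)%N) <= A / (1 - q) * q ^+ m * (1 - q ^+ k).
  apply: (le_trans h); rewrite ler_piMr//; last first.
    by rewrite gerBl exprn_ge0.
  by rewrite mulr_ge0 ?exprn_ge0// divr_ge0// ltW.
elim: k => [|k IH]; first by rewrite addn0 mdistxx expr0 subrr mulr0.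
apply: le_trans (metric_triangle _ (u (m + k)%N) _) _.
rewrite addnS; apply: le_trans (lerD IH (uq _)) _.
rewrite le_eqVlt; apply/orP; left; apply/eqP.
by rewrite exprD exprSr; field; rewrite gt_eqF.
Qed.

Lemma geometric_limit u A q :
  (forall F : set_system Y, ProperFilter F -> cauchy F -> exists p : Y, F --> p) ->
  0 <= A -> 0 < q < 1 ->
  (forall n, mdist (u n) (u n.+1) <= A * q ^+ n) ->
  exists p, u @ \oo --> p /\ mdist (u 0%N) p <= A / (1 - q).
Proof.
move=> complY A0 /andP[q0 q1] uq.
have q01 : 0 <= q < 1 by rewrite ltW.
have uq' := geometric_mdist_le A0 q01 uq.
have q10 : 0 < 1 - q by rewrite subr_gt0.
have [|p up] := complY (u @ \oo) _.
  apply: cauchy_exP => e e0.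
  have /(cvgr_lt _) : (fun n => A / (1 - q) * q ^+ n) @ \oo --> A / (1 - q) * 0.
    by apply: cvgMr; apply: cvg_expr; rewrite gtr0_norm.
  rewrite mulr0 => /(_ _ e0)[N _ /(_ N (leqnn N)) /= Ne].
  exists (u N); exists N => // n /= Nn.
  rewrite ballEmdist/= -(subnKC Nn); apply: le_lt_trans Ne; exact: uq'.
exists p; split => //.
apply/ler_addgt0Pr => e e0.
have /metricType_numDomainType.cvgr_dist_lt/(_ _ e0)[N _ /(_ N (leqnn N)) /= Ne] := up.
apply: le_trans (metric_triangle _ (u N) _) _.
apply: lerD; last by rewrite metric_sym ltW.
by have := uq' 0%N N; rewrite expr0 mulr1.
Qed.

End GeometricCauchy.

Section BoundaryDistance.
Context {R : realType} {X : metricType R} {Y : metricType R} (i : X -> Y).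
Context (b : X -> R) (w : X + set (R -> X)) (delta K eps : R).
Context (eps0 : 0 < eps) (delta0 : 0 <= delta) (K0 : 0 <= K).
Context (geoX : geodesic_space X) (bl : distance_limit b)
        (complY : is_completion (rho_eps eps b) i).

Local Notation rho := (rho_eps eps b).
Implicit Types (x y z : X) (xi : Y).

Lemma completion_mdist_le x y :
  mdist (i x) (i y) <= mdist x y * expR (eps * mdist x y) * rho x.
Proof.
case: complY => iE _ _; rewrite -lee_fin iE; exact: weighted_dist_le_mdist.
Qed.

Lemma completion_mdist_ge x y :
  expR (- eps) * rho x * Num.min 1 (mdist x y) <= mdist (i x) (i y).
Proof.
case: complY => iE _ _; rewrite -lee_fin iE; exact: weighted_dist_ge_mdist.
Qed.

Lemma completion_continuous : continuous i.
Proof.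
move=> x; apply/metricType_numDomainType.cvgrPdist_lt => e e0.
pose r := Num.min 1 (e / (expR eps * rho x)).
have er0 : 0 < expR eps * rho x by rewrite mulr_gt0 ?expR_gt0.
have r0 : 0 < r by rewrite lt_min ltr01 divr_gt0.
apply: (filterS _ (nbhsx_ballx x _ r0)) => y; rewrite ballEmdist/= lt_min => /andP[d1 de].
apply: le_lt_trans (completion_mdist_le x y) _.
rewrite ltr_pdivlMr// mulrA in de; apply: le_lt_trans de.
rewrite ler_wpM2r ?rho_eps_ge0// ler_wpM2l ?mdist_ge0// ler_expR.
by rewrite ler_piMr// ltW.
Qed.

(** Closed balls of [X] are compact, hence their images are closed in the
    completion, and a boundary point cannot be approached from inside one. *)
Lemma boundary_mdist_ge x xi : proper_space X -> metric_boundary i xi ->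
  expR (- eps) * rho x <= mdist (i x) xi.
Proof.
move=> propX bxi; rewrite leNgt; apply/negP => xxi; apply: bxi.
pose B := [set y | mdist x y <= 1].
suff : closure (i @` B) xi.
  have clB : closed (i @` B).
    apply: compact_closed; first exact: metric_hausdorff.
    apply: continuous_compact (propX x 1).
    exact/continuous_subspaceT/completion_continuous.
  by move=> /clB[y _ <-]; exists y.
move=> V /nbhs_ballP[e /= e0 eV].
pose r := Num.min e (expR (- eps) * rho x - mdist (i x) xi).
have r0 : 0 < r by rewrite lt_min e0 subr_gt0.
have [_ dense_i _] := complY.
have [||v [xiv [y _ yE]]] := dense_i (ball xi r)^°.
- by exists xi; exact: nbhsx_ballx.
- exact: open_interior.
exists (i y); have := interior_subset xiv.
rewrite -yE ballEmdist/= lt_min => /andP[ye yr].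
split; last by apply: eV; rewrite ballEmdist.
exists y => //; rewrite /B/= leNgt; apply/negP => xy.
have := completion_mdist_ge x y; rewrite min_l ?mulr1; last exact: ltW.
by have := metric_triangle (i x) xi (i y); lra.
Qed.

(** The first summand pays for the passage from [x] to the escaping ray, at
    distance at most [K + 1]; the second is the geometric series bounding the
    length of that ray. *)
Definition boundary_constant : R :=
  expR (eps * (K + 1)) * (K + 1 + expR (eps * (1 + 2 * delta)) / (1 - expR (- eps))).

(** The escaping ray has finite length, by comparison with a geometric series,
    so it converges in the completion; its limit lies on the boundary because
    the ray leaves every bounded set. *)
Lemma boundary_mdist_le x : gromov_hyperbolic X delta ->
  has_basepoint b w -> roughly_starlike K w ->
  exists2 xi, metric_boundary i xi & mdist (i x) xi <= boundary_constant * rho x.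
Proof.
move=> hypX bw star.
have [g [gg xg bg]] := starlike_escape x geoX hypX delta0 bw star.
have gI t : 0 <= t -> `[0, +oo[%classic t by move=> ?; rewrite /= in_itv/= andbT.
have gd s t : 0 <= s -> s <= t -> mdist (g s) (g t) = t - s.
  move=> s0 st; rewrite gg; [|exact: gI|exact: gI (le_trans s0 st)].
  by rewrite distrC ger0_norm ?subr_ge0.
pose A := expR (eps * (1 + 2 * delta)) * rho (g 0).
pose q := expR (- eps).
have q01 : 0 < q < 1 by rewrite expR_gt0 expR_lt1 oppr_lt0.
have A0 : 0 <= A by rewrite mulr_ge0 ?expR_ge0.
have step n : mdist (i (g n%:R)) (i (g n.+1%:R)) <= A * q ^+ n.
  apply: le_trans (completion_mdist_le _ _) _.
  rewrite gd ?ler0n// ?ler_nat// -natr1 addrAC subrr add0r mul1r mulr1.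
  rewrite /A /q /rho_eps -expRM_natl -!expRD ler_expR.
  have := ler_wpM2l (ltW eps0) (bg n%:R (ler0n _ _)); lra.
have [_ _ cplY] := complY.
have [xi [gxi g0xi]] := geometric_limit cplY A0 q01 step.
exists xi.
  move=> [y _ yxi].
  (* beyond distance 1 from [y] all points stay at [eps]-distance [e] from it *)
  pose e := expR (- eps) * rho y.
  have e0 : 0 < e by rewrite mulr_gt0 ?expR_gt0.
  have /metricType_numDomainType.cvgr_dist_lt/(_ _ e0)[N _ Ne] := gxi.
  pose n := maxn N (Num.truncn (1 + mdist y (g 0))).+1.
  have := Ne n (leq_maxl _ _); rewrite /= ltNge => /negP; apply.
  rewrite -yxi; apply: le_trans (completion_mdist_ge _ _).
  rewrite min_l ?mulr1//.
  have := metric_triangle (g 0) y (g n%:R); rewrite gd// subr0 (metric_sym _ y).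
  have : 1 + mdist y (g 0) < n%:R.
    apply: lt_le_trans (truncnS_gt _) _; rewrite ler_nat leq_maxr//.
  lra.
have rg : rho (g 0) <= expR (eps * (K + 1)) * rho x.
  by apply: rho_eps_le => //; apply: le_trans (distance_limit_lipschitz _ _ bl) _.
apply: le_trans (metric_triangle _ (i (g 0)) _) _.
rewrite /boundary_constant mulrDr mulrDl; apply: lerD.
  apply: le_trans (completion_mdist_le _ _) _.
  rewrite ler_wpM2r ?rho_eps_ge0// mulrC ler_pM ?expR_ge0 ?mdist_ge0//.
  by rewrite ler_expR ler_wpM2l// ltW.
apply: (le_trans g0xi); rewrite /A.
have q10 : 0 < 1 - expR (- eps) by rewrite subr_gt0 expR_lt1 oppr_lt0.
rewrite mulrAC -/q [X in _ <= X * _]mulrC -[leRHS]mulrA.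
by rewrite ler_wpM2l// divr_ge0 ?expR_ge0 ?ltW.
Qed.

End BoundaryDistance.

(** * Local doubling measures on geodesic spaces *)

Lemma metric_ball_open (R : realType) (X : metricType R) (x : X) (r : R) :
  open (ball x r).
Proof.
rewrite openE => y; rewrite ballEmdist/= => xy.
apply/nbhs_ballP; exists (r - mdist x y); rewrite /= ?subr_gt0//.
move=> z; rewrite !ballEmdist/= => yz.
by apply: le_lt_trans (metric_triangle _ y _) _; rewrite -ltrBrDl.
Qed.

Section SeparatedNet.
Context {R : realType} {X : metricType R}.
Implicit Types (x y z : X) (r s : R) (D : seq X).

Lemma compact_finite_net (A : set X) s : compact A -> 0 < s ->
  exists D, {in D, forall z, A z} /\
    forall y, A y -> exists2 z, z \in D & mdist z y < s.
Proof.
move=> /compact_near_coveringP covA s0.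
(* the filter of finite sets, ordered by inclusion *)
pose F := filter_from setT (fun D0 : seq X => [set D : seq X | {subset D0 <= D}]).
have FF : Filter F.
  apply: filter_fromT_filter; first by exists [::].
  move=> D1 D2; exists (D1 ++ D2) => D /= D12.
  by split => z zD; apply: D12; rewrite mem_cat zD ?orbT.
pose P (D : seq X) y := exists z, [/\ z \in D, A z & mdist z y < s].
have [x Ax|D0 _ /(_ D0 (fun=> id)) AD0] := covA _ F P FF.
  exists (ball x s, [set D : seq X | x \in D]) => /=.
    split; first exact: nbhsx_ballx.
    by exists [:: x] => // D /(_ x); apply; rewrite inE.
  by move=> [y D] [/=]; rewrite ballEmdist/= => xy xD; exists x.
exists [seq z <- D0 | `[< A z >]]; split.
  by move=> z; rewrite mem_filter => /andP[/asboolP].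
move=> y /AD0[z [zD Az zy]]; exists z => //; rewrite mem_filter zD andbT.
exact/asboolP.
Qed.

Lemma separated_subnet D s : exists D', [/\ {subset D' <= D},
  pairwise (fun z z' => s <= mdist z z') D' &
  {in D, forall y, exists2 z, z \in D' & mdist z y < s \/ z = y}].
Proof.
elim: D => [|x D [D' [DD' sepD' covD']]]; first by exists [::].
have [[z zD' zx]|far] := pselect (exists2 z, z \in D' & mdist z x < s).
  exists D'; split => //; first by move=> y /DD' yD; rewrite inE yD orbT.
  move=> y; rewrite inE => /predU1P[->|/covD'//]; by exists z => //; left.
exists (x :: D'); split => /=.
- move=> y; rewrite !inE => /predU1P[->|/DD' ->]; rewrite ?eqxx ?orbT//.
- rewrite sepD' andbT; apply/allP => z zD'; rewrite leNgt; apply/negP => xz.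
  by apply: far; exists z => //; rewrite metric_sym.
- move=> y; rewrite inE => /predU1P[->|/covD'[z zD' zy]].
    by exists x; [rewrite inE eqxx|right].
  by exists z => //; rewrite inE zD' orbT.
Qed.

End SeparatedNet.

Section LocalDoubling.
Context {R : realType}.


Lemma measure_bigsetU_le d (T : measurableType d) (mu : {measure set T -> \bar R})
  (I : Type) (D : seq I) (F : I -> set T) : (forall z, measurable (F z)) ->
  (mu (\big[setU/set0]_(z <- D) F z) <= \sum_(z <- D) mu (F z))%E.
Proof.
move=> mF; elim: D => [|z D IH]; first by rewrite !big_nil measure0.
rewrite !big_cons; apply: le_trans (measureU2 _ _ _) _ => //.
  exact: bigsetU_measurable.
exact: leeD2l.
Qed.

Lemma measure_bigsetU_pairwise d (T : measurableType d)
  (mu : {measure set T -> \bar R}) (I : eqType) (D : seq I) (F : I -> set T) :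
  (forall z, measurable (F z)) ->
  pairwise (fun z z' => `[< F z `&` F z' = set0 >]) D ->
  (mu (\big[setU/set0]_(z <- D) F z) = \sum_(z <- D) mu (F z))%E.
Proof.
move=> mF; elim: D => [|z D IH] /=; first by rewrite !big_nil measure0.
move=> /andP[/allP zD /IH {}IH]; rewrite !big_cons -IH measureU//.
  exact: bigsetU_measurable.
rewrite big_distrr/= big_seq big1//.
by move=> y /zD /asboolP.
Qed.

(** In a geodesic space the balls of radius [2 * R0] around a separated net of
    a ball cover a slightly larger ball, while the balls of radius [R0 / 4] are
    disjoint and stay inside. *)
Lemma doubling_enlarge d (X : metricMeasurableType d R)
  (mu : {measure set X -> \bar R}) (C R0 : R) (x : X) (r : R) :
  geodesic_space X -> proper_space X -> @open X `<=` measurable ->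
  0 < R0 -> 1 <= C -> doubling_upto mu C R0 -> R0 <= r ->
  (mu (ball x (r + R0 / 2)%R) <= (C ^+ 3)%:E * mu (ball x r))%E.
Proof.
move=> geoX propX mO R00 C1 dbl R0r.
set s := R0 / 2; have s0 : 0 < s by rewrite divr_gt0.
have R0E : R0 = 2 * s by rewrite /s; field.
have C0 : 0 <= C by apply: le_trans C1.
have mB (z : X) t : measurable (ball z t) by apply: mO; exact: metric_ball_open.
have [N [NA Nnet]] := compact_finite_net (propX x (r - s / 2)) s0.
have [D [DN Dsep Dnet]] := separated_subnet N s.
(* the net lives in radius [r - s / 2] to leave room for the disjoint balls *)
have cover : ball x (r + s) `<=` \big[setU/set0]_(z <- D) ball z (4 * s).
  move=> y; rewrite ballEmdist/= => xy.
  have [p xp py] : exists2 p, mdist x p <= r - s / 2 & mdist p y <= 3 / 2 * s.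
    have [le|lt] := leP (mdist x y) (r - s / 2).
      by exists y => //; rewrite mdistxx mulr_ge0 ?ltW//; lra.
    have [a [c [g gxy]]] := geoX x y; have [ac gg ga gc] := gxy.
    have xyE : mdist x y = c - a.
      by rewrite -ga -gc gg /= ?in_itv/= ?lexx ?ac// distrC ger0_norm ?subr_ge0.
    pose t := a + (r - s / 2).
    have act : a <= t <= c by rewrite /t; lra.
    have xgt : mdist x (g t) = r - s / 2.
      rewrite -ga gg /= ?in_itv/= ?lexx ?ac// distrC /t addrAC subrr add0r.
      by rewrite ger0_norm//; lra.
    exists (g t); first by rewrite xgt.
    by have := geodesic_betweenness gxy act; lra.
  have [z zN zp] := Nnet p xp.
  have [v vD vz] := Dnet z zN.
  rewrite -bigcup_seq; exists v => //; rewrite ballEmdist/=.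
  have {}vz : mdist v z < s by case: vz => [//|->]; rewrite mdistxx.
  have := metric_triangle v z p; have := metric_triangle v p y; lra.
have disj : pairwise (fun z z' =>
    `[< ball z (s / 2) `&` ball z' (s / 2) = set0 >]) D.
  apply: sub_pairwise Dsep => z z' zz'; apply/asboolP.
  rewrite -subset0 => y []; rewrite !ballEmdist/= => zy z'y.
  have := metric_triangle z y z'; rewrite (metric_sym y) leNgt => /negP; apply.
  by apply: lt_le_trans zz'; lra.
have inside : \big[setU/set0]_(z <- D) ball z (s / 2) `<=` ball x r.
  rewrite -bigcup_seq => y [z /= /DN/NA/= xz]; rewrite !ballEmdist/= => zy.
  have := metric_triangle x z y; lra.
have dbl3 z : (mu (ball z (4 * s)%R) <= (C ^+ 3)%:E * mu (ball z (s / 2)%R))%E.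
  have step t : 0 < t -> t <= 2 * s -> (mu (ball z (2 * t)%R) <= C%:E * mu (ball z t))%E.
    by move=> t0 ts; apply: dbl => //; rewrite R0E.
  have -> : 4 * s = 2 * (2 * s) by ring.
  apply: le_trans (step _ _ _) _; [by rewrite mulr_gt0|by []|].
  rewrite exprS EFinM -muleA lee_wpmul2l ?lee_fin//.
  apply: le_trans (step _ _ _) _; [by []|lra|].
  rewrite expr2 EFinM -muleA lee_wpmul2l ?lee_fin//.
  rewrite {1}(_ : s = 2 * (s / 2)); last by field.
  by apply: step; lra.
apply: le_trans (le_measure _ _ _ cover) _; rewrite ?inE//.
  exact: bigsetU_measurable.
apply: le_trans (measure_bigsetU_le _ _ _) _ => //.
apply: le_trans (lee_sum _ (fun z _ => dbl3 z)) _.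
rewrite -ge0_sume_distrr//.
rewrite lee_wpmul2l ?lee_fin ?exprn_ge0// -measure_bigsetU_pairwise//.
apply: le_measure => //; rewrite inE//; exact: bigsetU_measurable.
Qed.

(** Iterating [doubling_enlarge], a ball of radius [R0] reaches any prescribed
    radius in a number of steps that depends only on [R0] and [R1]. *)
Lemma doubling_upto_extend (C R0 R1 : R) : 0 < R0 -> 1 <= C ->
  exists2 C', 1 <= C' & forall d (X : metricMeasurableType d R)
    (mu : {measure set X -> \bar R}),
  geodesic_space X -> proper_space X -> @open X `<=` measurable ->
  doubling_upto mu C R0 -> doubling_upto mu C' R1.
Proof.
move=> R00 C1; have C0 : 0 <= C by apply: le_trans C1.
pose n := (Num.truncn (2 * R1 / (R0 / 2))).+1.
have Rn : 2 * R1 <= R0 + n%:R * (R0 / 2).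
  rewrite ler_wpDl ?ltW// -ltr_pdivrMr ?divr_gt0//; exact: truncnS_gt.
exists ((C ^+ 3) ^+ n); first by rewrite !exprn_ege1.
move=> d X mu geoX propX mO dbl x r r0 rR1.
have mB (z : X) t : measurable (ball z t) by apply: mO; exact: metric_ball_open.
have [rR0|/ltW R0r] := leP r R0.
  apply: le_trans (dbl _ _ r0 rR0) _; rewrite lee_wpmul2r ?measure_ge0 ?lee_fin//.
  by rewrite -exprM -[leLHS]expr1 ler_weXn2l//.
have grow m : (mu (ball x (R0 + m%:R * (R0 / 2))%R) <=
    ((C ^+ 3) ^+ m)%:E * mu (ball x R0))%E.
  elim: m => [|m IH]; first by rewrite mul0r addr0 expr0 mul1e.
  rewrite -natr1 mulrDl mul1r addrA.
  apply: le_trans (doubling_enlarge _ geoX propX mO R00 C1 dbl _) _.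
    by rewrite lerDl mulr_ge0// divr_ge0// ltW.
  by rewrite (exprS _ m) [in leRHS]EFinM -muleA lee_wpmul2l ?lee_fin ?exprn_ge0.
have sub (t u : R) : t <= u -> (mu (ball x t) <= mu (ball x u))%E.
  by move=> tu; apply: le_measure; rewrite ?inE//; exact: le_ball.
apply: le_trans (sub _ (R0 + n%:R * (R0 / 2)) _) _.
  by apply: le_trans Rn; rewrite ler_wpM2l.
apply: le_trans (grow n) _; rewrite lee_wpmul2l ?lee_fin ?exprn_ge0//.
exact: sub.
Qed.

Lemma doubling_dilation (C R0 lam R1 : R) : 0 < R0 -> 1 <= C ->
  exists2 C', 1 <= C' & forall d (X : metricMeasurableType d R)
    (mu : {measure set X -> \bar R}),
  geodesic_space X -> proper_space X -> @open X `<=` measurable ->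
  doubling_upto mu C R0 ->
  forall (x : X) r, 0 < r -> r <= R1 ->
    (mu (ball x (lam * r)%R) <= C'%:E * mu (ball x r))%E.
Proof.
move=> R00 C1; pose n := (Num.truncn lam).+1.
have [C' C'1 ext] := doubling_upto_extend (2 ^+ n * R1) R00 C1.
have C'0 : 0 <= C' by apply: le_trans C'1.
exists (C' ^+ n); first exact: exprn_ege1.
move=> d X mu geoX propX mO dbl x r r0 rR1.
have mB (z : X) t : measurable (ball z t) by apply: mO; exact: metric_ball_open.
have dbl' := ext _ _ _ geoX propX mO dbl.
have grow m : (m <= n)%N ->
    (mu (ball x (2 ^+ m * r)%R) <= (C' ^+ m)%:E * mu (ball x r))%E.
  elim: m => [_|m IH mn]; first by rewrite expr0 mul1r expr0 mul1e.
  rewrite exprS -mulrA; apply: le_trans (dbl' _ _ _ _) _.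
  - by rewrite mulr_gt0 ?exprn_gt0.
  - apply: ler_pM; [by rewrite exprn_ge0|exact: ltW| |by []].
    by rewrite ler_weXn2l ?ler1n// ltnW.
  by rewrite exprS EFinM -muleA lee_wpmul2l ?lee_fin// IH// ltnW.
apply: le_trans (grow n (leqnn n)).
apply: le_measure; rewrite ?inE//; apply: le_ball; rewrite ler_wpM2r ?ltW//.
apply: lt_le_trans (truncnS_gt _) _; rewrite -/n -natrX ler_nat.
exact/ltnW/ltn_expl.
Qed.

End LocalDoubling.

(** * Doubling of the weighted measure *)

(** Both cases of the doubling estimate end this way: the measures of the large
    set [U] and of the small set [V] are compared, with the same weight [E], to
    those of two balls of [X]. *)
Lemma lee_chain (R : realType) (E k1 k2 k3 : R) (m1 m2 U V : \bar R) :
  0 <= E -> 0 <= k1 -> 0 <= k2 -> 0 < k3 ->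
  (U <= (k1 * E)%:E * m1)%E -> (m1 <= k2%:E * m2)%E ->
  ((k3 * E)%:E * m2 <= V)%E -> (U <= (k1 * k2 / k3)%:E * V)%E.
Proof.
move=> E0 k10 k20 k30 Um1 m12 m2V; apply: (le_trans Um1).
apply: (@le_trans _ _ ((k1 * E)%:E * (k2%:E * m2))%E).
  by rewrite lee_wpmul2l// lee_fin mulr_ge0.
apply: (@le_trans _ _ ((k1 * k2 / k3)%:E * ((k3 * E)%:E * m2))%E).
  rewrite !muleA -!EFinM (_ : k1 * E * k2 = k1 * k2 / k3 * (k3 * E))//.
  by field; rewrite gt_eqF.
by rewrite lee_wpmul2l// lee_fin divr_ge0 ?mulr_ge0// ltW.
Qed.

Section MuBeta.
Context {R : realType} {d : measure_display} {X : metricMeasurableType d R}.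
Context {Y : metricType R} (i : X -> Y).
Context (mu : {measure set X -> \bar R}) (mO : @open X `<=` measurable).
Context (beta : R) (b : X -> R) (beta0 : 0 < beta) (bl : distance_limit b).
Implicit Types (A B : set Y) (x : X) (t : R).

Lemma mu_beta_ge0 A : (0 <= mu_beta mu beta b i A)%E.
Proof. by apply: integral_ge0 => x _; rewrite lee_fin expR_ge0. Qed.

Lemma mu_beta_mono A B : i @^-1` A `<=` i @^-1` B ->
  (mu_beta mu beta b i A <= mu_beta mu beta b i B)%E.
Proof.
move=> AB; apply: ge0_integral_mono => // x _.
by rewrite !lee_fin expR_ge0 lexx.
Qed.

Lemma mu_beta_le_ball A x t : i @^-1` A `<=` ball x t ->
  (mu_beta mu beta b i A <=
    (expR (beta * t) * expR (- (beta * b x)))%:E * mu (ball x t))%E.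
Proof.
move=> At; apply: (@le_trans _ _ (\int[mu]_(y in ball x t) (expR (- (beta * b y)))%:E)%E).
  apply: ge0_integral_mono => // y _.
  by rewrite !lee_fin expR_ge0 lexx.
apply: integral_le_cst; first by apply: mO; exact: metric_ball_open.
move=> y; rewrite ballEmdist/= => xy; rewrite expR_ge0 -expRD ler_expR/=.
have bxy : b x - b y <= t.
  by apply: le_trans (distance_limit_lipschitz x y bl) (ltW xy).
have := ler_wpM2l (ltW beta0) bxy; lra.
Qed.

Lemma mu_beta_ge_ball A x t : ball x t `<=` i @^-1` A ->
  ((expR (- (beta * t)) * expR (- (beta * b x)))%:E * mu (ball x t) <=
    mu_beta mu beta b i A)%E.
Proof.
move=> At; apply: integral_ge_cst => //.
  by apply: mO; exact: metric_ball_open.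
move=> y; rewrite ballEmdist/= => xy; rewrite -expRD ler_expR/=.
have bxy : b y - b x <= t.
  by apply: le_trans (distance_limit_lipschitz y x bl) _; rewrite metric_sym ltW.
have := ler_wpM2l (ltW beta0) bxy; lra.
Qed.

End MuBeta.

Lemma boundary_constant_ge1 (R : realType) (delta K eps : R) :
  0 < eps -> 0 <= K -> 1 <= boundary_constant delta K eps.
Proof.
move=> eps0 K0; rewrite /boundary_constant.
have e1 : 1 <= expR (eps * (K + 1)).
  by rewrite -expR0 ler_expR mulr_ge0 ?(ltW eps0) ?addr_ge0.
have q0 : 0 <= expR (eps * (1 + 2 * delta)) / (1 - expR (- eps)).
  by rewrite divr_ge0 ?expR_ge0// subr_ge0 ltW// expR_lt1 oppr_lt0.
by apply: (le_trans e1); rewrite ler_peMr ?expR_ge0//; lra.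
Qed.

Section Doubling.
Context {R : realType} (delta K eps M beta R0 Cmu C0 : R).
Context (hpar : admissible delta K eps M) (hbeta : 0 < beta) (hR0 : 0 < R0).
Context (hCmu : 1 <= Cmu) (hC0 : 1 <= C0).

Let D := boundary_constant delta K eps.

(** Balls that are far from the boundary are comparable with balls of [X] of
    bounded radius, on which [mu] is doubling and the weight nearly constant. *)
Lemma doubling_far_ball : exists2 C, 0 <= C &
  forall (d : measure_display) (X : metricMeasurableType d R)
      (mu : {measure set X -> \bar R}) (b : X -> R) (w : X + set (R -> X))
      (Y : metricType R) (i : X -> Y),
    uniformization delta K eps M b w i ->
    borel_regular mu -> doubling_upto mu Cmu R0 ->
    forall (x : X) (r : R), 0 < r ->
    (forall xi, metric_boundary i xi -> 4 * r <= mdist (i x) xi) ->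
    (mu_beta mu beta b i (ball (i x) (2 * r)%R) <=
       C%:E * mu_beta mu beta b i (ball (i x) r))%E.
Proof.
have [delta0 K0 eps0 M1] := hpar.
have D1 : 1 <= D by exact: boundary_constant_ge1.
have D0 : 0 < D by exact: lt_le_trans D1.
(* [rho >= a * rho x] on the ball of radius [2 r] around [x] *)
pose a := expR (- eps) / (2 * D).
have a0 : 0 < a.
  by rewrite /a divr_gt0 ?expR_gt0// mulr_gt0.
have M0 : 0 < M by exact: lt_le_trans M1.
(* the ball of radius [2 r] lies in the ball of [X] of radius [T * (r / rho x)] *)
pose T := 2 * M * expR (eps * delta) / a.
have T0 : 0 < T by rewrite /T divr_gt0// mulr_gt0 ?expR_gt0// mulr_gt0.
(* the ball of [X] of radius [c * (r / rho x)] lies in the ball of radius [r] *)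
pose c := expR (- (eps * D)).
have c0 : 0 < c by exact: expR_gt0.
have c1 : c <= 1.
  by rewrite /c -expR0 ler_expR oppr_le0; apply: mulr_ge0; exact: ltW.
have [C' C'1 dil] := doubling_dilation (T / c) D hR0 hCmu.
have C'0 : 0 <= C' by apply: le_trans C'1.
exists (expR (beta * (T * D)) * C' / expR (- (beta * D))).
  by rewrite divr_ge0 ?mulr_ge0 ?expR_ge0.
move=> d X mu b w Y i unif [mO _] dbl x r r0 far.
have [[propX geoX hypX] bw star GH cplY] := unif.
have bl := basepoint_distance_limit bw.
have iE : forall x y, (mdist (i x) (i y))%:E = weighted_dist (rho_eps eps b) x y.
  by case: cplY.
pose rho := rho_eps eps b.
have rho0 y : 0 < rho y by exact: rho_eps_gt0.
have near y := boundary_mdist_le eps0 delta0 geoX bl cplY y hypX bw star.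
have rD : r / rho x <= D.
  have [xi bxi xxi] := near x.
  rewrite ler_pdivrMr//; have := far _ bxi; rewrite -/D -/rho in xxi; lra.
have rr0 : 0 < r / rho x by rewrite divr_gt0.
apply: (lee_chain (E := expR (- (beta * b x))) (m1 := mu (ball x (T * (r / rho x))))
  (m2 := mu (ball x (c * (r / rho x))))); rewrite ?expR_ge0 ?expR_gt0//.
- apply: le_trans (@mu_beta_le_ball _ _ _ _ i mu mO _ _ hbeta bl _ x
    (T * (r / rho x)) _) _.
    move=> y; rewrite /= !ballEmdist/= => xy.
    have ary : a * rho x <= rho y.
      have [xi bxi yxi] := near y.
      have h1 := far _ bxi.
      have h2 := boundary_mdist_ge eps0 geoX bl cplY x propX bxi.
      have h3 := metric_triangle (i x) (i y) xi.
      rewrite /a mulrAC ler_pdivrMr; last exact: mulr_gt0.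
      rewrite -/D -/rho in h2 yxi; lra.
    have armin : a * rho x <= Num.min (rho x) (rho y).
      rewrite le_min ary andbT -[leRHS]mul1r ler_wpM2r ?(ltW (rho0 x))//.
      rewrite /a ler_pdivrMr; last exact: mulr_gt0.
      have : expR (- eps) <= 1 by rewrite -expR0 ler_expR oppr_le0 ltW.
      by lra.
    have := GH_density_mdist_le x y eps0 geoX hypX bl GH.
    rewrite -iE -EFinM lee_fin -/rho => gh.
    have {}gh : mdist x y * expR (- (eps * delta)) * (a * rho x) < M * (2 * r).
      apply: le_lt_trans (le_trans _ gh) _.
        by rewrite ler_wpM2l ?mulr_ge0 ?mdist_ge0 ?expR_ge0.
      by rewrite ltr_pM2l//; lra.
    have -> : T * (r / rho x) = M * (2 * r) / (expR (- (eps * delta)) * (a * rho x)).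
      rewrite /T expRN; field.
      by rewrite !gt_eqF ?expR_gt0.
    have e0 : 0 < expR (- (eps * delta)) * (a * rho x).
      by apply: mulr_gt0; [exact: expR_gt0|exact: mulr_gt0].
    by rewrite ltr_pdivlMr// [ltLHS]mulrA.
  rewrite lee_wpmul2r ?measure_ge0// lee_fin ler_wpM2r ?expR_ge0//.
  by rewrite ler_expR ler_wpM2l ?ler_wpM2l// ltW.
- have -> : T * (r / rho x) = T / c * (c * (r / rho x)) by field; rewrite !gt_eqF.
  apply: dil => //; first exact: mulr_gt0.
  by apply: le_trans rD; rewrite ler_piMl// ltW.
- apply: le_trans _ (@mu_beta_ge_ball _ _ _ _ i mu mO _ _ hbeta bl _ x
    (c * (r / rho x)) _).
    rewrite lee_wpmul2r ?measure_ge0// lee_fin ler_wpM2r ?expR_ge0//.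
    rewrite ler_expR lerN2 ler_wpM2l ?(ltW hbeta)//.
    by apply: le_trans rD; rewrite ler_piMl// ltW.
  move=> y; rewrite /= !ballEmdist/= => xy.
  apply: le_lt_trans (completion_mdist_le eps0 geoX bl cplY x y) _.
  have xyD : mdist x y <= D.
    by apply: le_trans (ltW xy) (le_trans _ rD); rewrite ler_piMl// ltW.
  rewrite -/rho -ltr_pdivlMr//.
  apply: (@le_lt_trans _ _ (mdist x y / c)).
    rewrite ler_wpM2l ?mdist_ge0// /c expRN invrK ler_expR ler_wpM2l// ltW//.
  by rewrite ltr_pdivrMr// mulrC.
Qed.

(** Balls close to the boundary sit in a ball centered at a boundary point, to
    which the hypothesis applies with the corkscrew point [z] of the given ball;
    conversely the ball around [z] is large enough to contain a ball of [X] of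
    definite radius, and there the weight is comparable to [r `^ (beta / eps)]. *)
Lemma doubling_near_ball (kappa : R) : 0 < kappa -> exists2 C, 0 <= C &
  forall (d : measure_display) (X : metricMeasurableType d R)
      (mu : {measure set X -> \bar R}) (b : X -> R) (w : X + set (R -> X))
      (Y : metricType R) (i : X -> Y),
    uniformization delta K eps M b w i ->
    borel_regular mu -> doubling_upto mu Cmu R0 ->
    forall (y xi : Y) (z : X) (r : R), 0 < r ->
    metric_boundary i xi -> mdist y xi < 4 * r ->
    ball (i z) (kappa * r) `<=` ball y r ->
    ((2 * kappa * r)%:E <= dist_boundary i z)%E ->
    (mu_beta mu beta b i (ball xi (10 * r)%R)
       <= (C0 * (10 * r) `^ (beta / eps))%:E * mu (ball z R0))%E ->
    (mu_beta mu beta b i (ball y (2 * r)%R) <=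
       C%:E * mu_beta mu beta b i (ball y r))%E.
Proof.
move=> kappa0; have [delta0 K0 eps0 M1] := hpar.
have D1 : 1 <= D by exact: boundary_constant_ge1.
have D0 : 0 < D by exact: lt_le_trans D1.
have C00 : 0 <= C0 by exact: le_trans hC0.
pose p := beta / eps.
pose q := expR (- eps).
have q0 : 0 < q by exact: expR_gt0.
(* since [rho z <= 5 * r / q], the ball of [X] of radius [t] around [z] lies in
   the ball of radius [kappa * r] *)
pose t := Num.min 1 (kappa * q * q / 5).
have t0 : 0 < t by rewrite /t lt_min ltr01 divr_gt0 ?mulr_gt0.
have [C' C'1 dil] := doubling_dilation (R0 / t) t hR0 hCmu.
have C'0 : 0 <= C' by apply: le_trans C'1.
pose k3 := expR (- (beta * t)) * (2 * kappa / D) `^ p.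
have k30 : 0 < k3.
  rewrite /k3 mulr_gt0 ?expR_gt0// powR_gt0// divr_gt0// mulr_gt0//.
exists (C0 * 10 `^ p * C' / k3).
  by rewrite divr_ge0 ?mulr_ge0 ?powR_ge0// ltW.
move=> d X mu b w Y i unif [mO _] dbl y xi z r r0 bxi yxi ziny zfar hmu.
have [[propX geoX hypX] bw star GH cplY] := unif.
have bl := basepoint_distance_limit bw.
pose rho := rho_eps eps b.
have rho0 : 0 < rho z by exact: rho_eps_gt0.
have yz : mdist y (i z) < r.
  have := ziny (i z); rewrite !ballEmdist/= mdistxx; apply; exact: mulr_gt0.
have rho_le : rho z * q <= 5 * r.
  have := boundary_mdist_ge eps0 geoX bl cplY z propX bxi.
  rewrite -/rho -/q mulrC => /le_trans; apply.
  have := metric_triangle (i z) y xi; rewrite (metric_sym _ y); lra.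
have rho_ge : 2 * kappa / D * r <= rho z.
  have [xi' bxi' zxi'] := boundary_mdist_le eps0 delta0 geoX bl cplY z hypX bw star.
  have : (dist_boundary i z <= (mdist (i z) xi')%:E)%E.
    by apply: ereal_inf_lbound; exists xi'.
  move=> /(le_trans zfar); rewrite lee_fin => h.
  rewrite mulrAC ler_pdivrMr//; apply: (le_trans h).
  by rewrite mulrC.
have weight : (2 * kappa / D) `^ p * r `^ p <= expR (- (beta * b z)).
  have k0 : 0 <= 2 * kappa / D by rewrite ltW// divr_gt0// mulr_gt0.
  have -> : - (beta * b z) = - (eps * b z) * p.
    by rewrite /p; field; rewrite gt_eqF.
  rewrite expRM -powRM//; last exact: ltW.
  apply: ge0_ler_powR => //; rewrite ?nnegrE ?expR_ge0//.
  - by rewrite divr_ge0// ltW.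
  - by rewrite mulr_ge0// ltW.
apply: (lee_chain (E := r `^ p) (m1 := mu (ball z R0)) (m2 := mu (ball z t)));
  rewrite ?powR_ge0 ?mulr_ge0 ?powR_ge0//.
- rewrite -mulrA -powRM//; last exact: ltW.
  apply: le_trans hmu; apply: mu_beta_mono => v /=.
  rewrite !ballEmdist/= => yv.
  have := metric_triangle xi y (i v); rewrite (metric_sym xi y); lra.
- have {1}-> : R0 = R0 / t * t by field; rewrite gt_eqF.
  exact: dil.
- apply: le_trans _ (@mu_beta_ge_ball _ _ _ _ i mu mO _ _ hbeta bl _ z t _).
    rewrite lee_wpmul2r ?measure_ge0// lee_fin /k3 -mulrA.
    by rewrite ler_wpM2l ?expR_ge0.
  move=> v zv; apply: ziny; move: zv; rewrite !ballEmdist/= => zv.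
  apply: le_lt_trans (completion_mdist_le eps0 geoX bl cplY z v) _.
  have t1 : t <= 1 by rewrite /t ge_min lexx.
  have tk : t <= kappa * q * q / 5 by rewrite /t ge_min lexx orbT.
  apply: (@le_lt_trans _ _ (mdist z v / q * (5 * r / q))).
    apply: ler_pM; rewrite ?mulr_ge0 ?mdist_ge0 ?expR_ge0 ?rho_eps_ge0//.
      rewrite ler_wpM2l ?mdist_ge0// /q expRN invrK ler_expR.
      by rewrite -[leRHS]mulr1 ler_wpM2l ?(ltW eps0)// (le_trans (ltW zv)).
    by rewrite ler_pdivlMr.
  have -> : mdist z v / q * (5 * r / q) = mdist z v * (5 * r / (q * q)).
    by field; rewrite gt_eqF.
  have -> : kappa * r = kappa * q * q / 5 * (5 * r / (q * q)).
    by field; rewrite gt_eqF.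
  rewrite ltr_pM2r; first exact: lt_le_trans tk.
  by rewrite divr_gt0 ?mulr_gt0.
Qed.

End Doubling.

(** By density of [X], a bound on its diameter extends to the completion. *)
Lemma ball_beyond_diam (R : realType) (X Y : metricType R) (i : X -> Y)
    (rho : X -> R) (y : Y) (r : R) : 0 < r -> is_completion rho i ->
  (2%:E * weighted_diam rho < r%:E)%E -> forall x, ball y r (i x).
Proof.
move=> r0 [iE dense_i _] diamr x.
have [D diamE [D0 Dr]] : exists2 D : R, weighted_diam rho = D%:E & 0 <= D /\ 2 * D < r.
  have : (0 <= weighted_diam rho)%E.
    have <- : weighted_dist rho x x = 0%E by rewrite -iE mdistxx.
    by apply: ereal_sup_ubound; exists x, x.
  move: diamr; case: (weighted_diam rho) => [D| |//].
    by rewrite -EFinM lte_fin lee_fin => Dr D0; exists D.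
  by rewrite mulry gtr0_sg// mul1e.
have e0 : 0 < r - D by lra.
have [||v [vy [x' _ x'v]]] := dense_i (ball y (r - D))^°.
- by exists y; exact: nbhsx_ballx.
- exact: open_interior.
have := interior_subset vy; rewrite -x'v !ballEmdist/= => yx'.
have : mdist (i x') (i x) <= D.
  by rewrite -lee_fin iE -diamE; apply: ereal_sup_ubound; exists x', x.
by have := metric_triangle y (i x') (i x); lra.
Qed.

Theorem proposition3p3 (R : realType) (kappa0 : R -> R -> R -> R -> R)
    (hkappa0 : corkscrew_constant kappa0)
    (delta K eps M beta R0 Cmu C0 : R)
    (hpar : admissible delta K eps M) (hbeta : 0 < beta) (hR0 : 0 < R0)
    (hCmu : 1 <= Cmu) (hC0 : 1 <= C0) :
  let kappa1 := kappa0 delta K eps M / 10 in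
  exists C : R, 1 <= C /\
    forall (d : measure_display) (X : metricMeasurableType d R)
      (mu : {measure set X -> \bar R}) (b : X -> R) (w : X + set (R -> X))
      (Y : metricType R) (i : X -> Y),
    uniformization delta K eps M b w i ->
    borel_regular mu ->
    doubling_upto mu Cmu R0 ->
    (forall (xi : Y) (r : R) (z : X), metric_boundary i xi -> 0 < r ->
       ball (i z) (kappa1 * r) `<=` ball xi r ->
       ((2 * kappa1 * r)%:E <= dist_boundary i z)%E ->
       (mu_beta mu beta b i (ball xi r)
          <= (C0 * r `^ (beta / eps))%:E * mu (ball z R0))%E) ->
    doubling (mu_beta mu beta b i) C.
Proof.
have [kappa_gt0 cork] := hkappa0 _ _ _ _ hpar.
set kappa := kappa0 delta K eps M in kappa_gt0 cork *.
have [C1 C10 far] := doubling_far_ball hpar hbeta hR0 hCmu.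
have [C2 C20 near] := doubling_near_ball hpar hbeta hR0 hCmu hC0 kappa_gt0.
exists (1 + C1 + C2); split; first by lra.
move=> d X mu b w Y i unif reg dbl hmu y r r0.
have enlarge (c : R) A : c <= 1 + C1 + C2 ->
    (c%:E * mu_beta mu beta b i A <= (1 + C1 + C2)%:E * mu_beta mu beta b i A)%E.
  by move=> cC; rewrite lee_wpmul2r ?mu_beta_ge0// lee_fin.
have [[xi bxi yxi]|nofar] := pselect (exists2 xi, metric_boundary i xi &
    mdist y xi < 4 * r); last first.
  have [[x _ xy]|by_] := pselect (range i y); last first.
    by exfalso; apply: nofar; exists y; rewrite // mdistxx mulr_gt0.
  rewrite -xy; apply: le_trans (far _ _ _ _ _ _ _ unif reg dbl _ _ r0 _) _.
    move=> xi bxi; rewrite leNgt; apply/negP => yxi.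
    by apply: nofar; exists xi => //; rewrite -xy.
  by apply: enlarge; lra.
have [rdiam|diamr] := leP r%:E (2%:E * weighted_diam (rho_eps eps b))%E; last first.
  have [_ _ _ _ cplY] := unif.
  apply: (@le_trans _ _ (1%:E * mu_beta mu beta b i (ball y r))%E).
    rewrite mul1e; apply: mu_beta_mono => x _.
    exact: ball_beyond_diam r0 cplY diamr x.
  by apply: enlarge; lra.
have [z [ziny zfar]] := cork _ _ _ _ _ unif y r r0 rdiam.
have kE : kappa / 10 * (10 * r) = kappa * r by field.
apply: le_trans (near _ _ _ _ _ _ _ unif reg dbl y xi z r r0 bxi yxi ziny zfar _) _.
  apply: hmu => //; first by rewrite mulr_gt0.
    rewrite kE => v /ziny; rewrite !ballEmdist/= => yv.
    have := metric_triangle xi y v; rewrite (metric_sym xi y); lra.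
  by rewrite -mulrA kE mulrA.
by apply: enlarge; lra.
Qed.
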